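(* Let $A$ and $B$ be Morita equivalent $\Bbbk$-algebras over a field $\Bbbk$. Let $f$ be a Hochschild $2$-cocycle of $A$ and $g$ a Hochschild $2$-cocycle of $B$ such that $[f]\in\mathsf{HH}^2(A)$ and $[g]\in\mathsf{HH}^2(B)$ correspond to each other under the transfer isomorphism $\widetilde{\phi^2}:\mathsf{HH}^2(A)\to\mathsf{HH}^2(B)$, i.e. $\widetilde{\phi^2}([f])=[g]$. Then the infinitesimal deformations $A_f$ and $B_g$ are Morita equivalent.
   Context: Algebras are associative and unital over a field $\Bbbk$. Morita data: $A$ and $B$ are Morita equivalent, i.e. there are bimodules ${}_AP_B$, ${}_BQ_A$ and bimodule isomorphisms $\langle-,-\rangle_A:P\otimes_BQ\to A$ and $\langle-,-\rangle_B:Q\otimes_AP\to B$, chosen so that for all $p,p'\in P$, $q,q'\in Q$: $\langle p,q\rangle_A\,p'=p\,\langle q,p'\rangle_B$ and $\langle q,p\rangle_B\,q'=q\,\langle p,q'\rangle_A$. One fixes $q_k\in Q$, $p_k\in P$ with $1_B=\sum_{k=1}^{m}\langle q_k,p_k\rangle_B$. A Hochschild $2$-cocycle of $A$ is a $\Bbbk$-linear $f:A\otimes_\Bbbk A\to A$ with $a_0f(a_1\otimes a_2)+f(a_0\otimes a_1a_2)=f(a_0a_1\otimes a_2)+f(a_0\otimes a_1)a_2$; $\mathsf{HH}^2(A)$ is the space of $2$-cocycles modulo the maps $a_0\otimes a_1\mapsto a_0h(a_1)-h(a_0a_1)+h(a_0)a_1$ with $h\in\operatorname{Hom}_\Bbbk(A,A)$.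 Transfer isomorphism: $\widetilde{\phi^2}([f])=[\phi^2(f)]$, where $\phi^2(f)(b_1\otimes b_2)=\sum_{1\le i_0,i_1,i_2\le m}\langle q_{i_0},f(\langle p_{i_0},b_1q_{i_1}\rangle_A\otimes\langle p_{i_1},b_2q_{i_2}\rangle_A)\,p_{i_2}\rangle_B$; this is an isomorphism $\mathsf{HH}^2(A)\to\mathsf{HH}^2(B)$, independent of the choice of the $q_k,p_k$. Infinitesimal deformation: for a $2$-cocycle $f$ of $A$, $A_f$ is the algebra with underlying space $A[t]/(t^2)\simeq A\oplus A$ and multiplication $(a_0,b_0)(a_1,b_1)=(a_0a_1,\;a_0b_1+b_0a_1+f(a_0\otimes a_1))$. Similarly $B_g$. Two algebras $R,S$ are Morita equivalent if there are bimodules ${}_RX_S$, ${}_SY_R$ with $X\otimes_SY\simeq R$ and $Y\otimes_RX\simeq S$ as bimodules. *)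

(* Defs.v *)
From HB Require Import structures.
From mathcomp Require Import all_boot all_algebra boolp.

Set Implicit Arguments.
Unset Strict Implicit.
Unset Printing Implicit Defensive.

Import GRing.Theory.

Local Open Scope ring_scope.
Local Open Scope quotient_scope.

(* Bimodules over k-algebras are k-central: the two actions restrict to the
   same action of k, which is the k-bilinearity of [lact] and [ract]. *)
Record bimod (k : fieldType) (A B : algType k) := Bimod {
  bmod :> lmodType k;
  lact : {bilinear A -> bmod -> bmod};
  ract : {bilinear bmod -> B -> bmod};
  lact1 : forall x, lact 1 x = x;
  lactA : forall a a' x, lact a (lact a' x) = lact (a * a') x;
  ract1 : forall x, ract x 1 = x;
  ractA : forall x b b', ract (ract x b) b' = ract x (b * b');
  lractA : forall a x b, lact a (ract x b) = ract (lact a x) b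
}.

Notation "a *> x" := (lact _ a x) (at level 40, left associativity).
Notation "x <* b" := (ract _ x b) (at level 40, left associativity).

Record bimod_iso (k : fieldType) (A B : algType k) (X Y : bimod A B) :=
  BimodIso {
    iso_fun :> {linear X -> Y};
    isoL : forall a x, iso_fun (a *> x) = a *> iso_fun x;
    isoR : forall x b, iso_fun (x <* b) = iso_fun x <* b;
    iso_bij : bijective iso_fun
  }.

Section ActionTheory.
Variables (k : fieldType) (A B : algType k) (X : bimod A B).
Implicit Types (a : A) (b : B) (x : X) (c : k).

Lemma lactDl a a' x : (a + a') *> x = a *> x + a' *> x.
Proof. exact: linearDl. Qed.
Lemma lactDr a x x' : a *> (x + x') = a *> x + a *> x'.
Proof. exact: linearDr. Qed.
Lemma lactBl a a' x : (a - a') *> x = a *> x - a' *> x.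
Proof. exact: linearBl. Qed.
Lemma lactZl c a x : (c *: a) *> x = c *: (a *> x).
Proof. exact: linearZl_LR. Qed.
Lemma lactZr c a x : a *> (c *: x) = c *: (a *> x).
Proof. exact: linearZr_LR. Qed.
Lemma lact0r a : a *> (0 : X) = 0.
Proof. exact: linear0r. Qed.
Lemma ractDl x x' b : (x + x') <* b = x <* b + x' <* b.
Proof. exact: linearDl. Qed.
Lemma ractDr x b b' : x <* (b + b') = x <* b + x <* b'.
Proof. exact: linearDr. Qed.
Lemma ractZl c x b : (c *: x) <* b = c *: (x <* b).
Proof. exact: linearZl_LR. Qed.
Lemma ractZr c x b : x <* (c *: b) = c *: (x <* b).
Proof. exact: linearZr_LR. Qed.
Lemma ract0l b : (0 : X) <* b = 0.
Proof. exact: linear0l. Qed.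

Lemma lact_suml I (r : seq I) (F : I -> A) x :
  (\sum_(i <- r) F i) *> x = \sum_(i <- r) F i *> x.
Proof. exact: linear_sumlz. Qed.
Lemma lact_sumr I (r : seq I) a (F : I -> X) :
  a *> (\sum_(i <- r) F i) = \sum_(i <- r) a *> F i.
Proof. exact: linear_sumr. Qed.
Lemma ract_suml I (r : seq I) (F : I -> X) b :
  (\sum_(i <- r) F i) <* b = \sum_(i <- r) F i <* b.
Proof. exact: linear_sumlz. Qed.
Lemma ract_sumr I (r : seq I) x (F : I -> B) :
  x <* (\sum_(i <- r) F i) = \sum_(i <- r) x <* F i.
Proof. exact: linear_sumr. Qed.

End ActionTheory.

Section Regular.
Variables (k : fieldType) (A : algType k).

Definition reg_mul (a a' : A) : A := a * a'.

Fact reg_mul_bilinear : bilinear_for *:%R *:%R reg_mul.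
Proof.
split=> a c u v; rewrite /reg_mul /=.
  by rewrite mulrDl -scalerAl.
by rewrite mulrDr -scalerAr.
Qed.
HB.instance Definition _ :=
  bilinear_isBilinear.Build k A A A *:%R *:%R reg_mul reg_mul_bilinear.

Definition regular : bimod A A :=
  @Bimod k A A A reg_mul reg_mul (@mul1r A) (@mulrA A) (@mulr1 A)
    (fun x b b' => esym (mulrA x b b')) (@mulrA A).

End Regular.

Section Tensor.
Variables (k : fieldType) (A B C : algType k) (X : bimod A B) (Y : bimod B C).

(* The list [:: (x_1, y_1); ...; (x_n, y_n)] stands for the formal sum
   x_1 (x) y_1 + ... + x_n (x) y_n.  [tens_eq] is the congruence presenting
   the abelian group X (x)_B Y; opposites are obtained by negating the x_i. *)
Inductive tens_eq : seq (X * Y) -> seq (X * Y) -> Prop :=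
| tens_refl s : tens_eq s s
| tens_sym s t : tens_eq s t -> tens_eq t s
| tens_trans s t u : tens_eq s t -> tens_eq t u -> tens_eq s u
| tens_cat s s' t t' :
    tens_eq s s' -> tens_eq t t' -> tens_eq (s ++ t) (s' ++ t')
| tens_catC s t : tens_eq (s ++ t) (t ++ s)
| tens_0l y : tens_eq [:: (0, y)] [::]
| tens_Dl x x' y : tens_eq [:: (x + x', y)] [:: (x, y); (x', y)]
| tens_Dr x y y' : tens_eq [:: (x, y + y')] [:: (x, y); (x, y')]
| tens_bal x b y : tens_eq [:: (x <* b, y)] [:: (x, b *> y)].

Definition tens_rel : rel (seq (X * Y)) := fun s t => `[< tens_eq s t >].

Fact tens_rel_refl : reflexive tens_rel.
Proof. by move=> s; apply/asboolP; apply: tens_refl. Qed.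
Fact tens_rel_sym : symmetric tens_rel.
Proof. by move=> s t; apply/asboolP/asboolP; apply: tens_sym. Qed.
Fact tens_rel_trans : transitive tens_rel.
Proof.
by move=> t s u /asboolP st /asboolP tu; apply/asboolP; apply: tens_trans tu.
Qed.
Canonical tens_equiv :=
  EquivRel tens_rel tens_rel_refl tens_rel_sym tens_rel_trans.

Definition tens := {eq_quot tens_equiv}.
HB.instance Definition _ := Choice.on tens.
HB.instance Definition _ := EqQuotient.on tens.

Definition tcls (s : seq (X * Y)) : tens := \pi_tens s.
Definition tpure (x : X) (y : Y) : tens := tcls [:: (x, y)].

Lemma tclsP s t : tcls s = tcls t <-> tens_eq s t.
Proof.
split; first by move/eqmodP/asboolP.
by move=> st; apply/eqmodP/asboolP.
Qed.

Lemma tens_repr s : tens_eq (repr (tcls s)) s.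
Proof. by apply/tclsP; rewrite /tcls reprK. Qed.

Lemma tens_ind (P : tens -> Prop) : (forall s, P (tcls s)) -> forall u, P u.
Proof. by move=> Ps u; rewrite -[u]reprK; apply: Ps. Qed.

Definition tadd (u v : tens) : tens := tcls (repr u ++ repr v).

Lemma tadd_cls s t : tadd (tcls s) (tcls t) = tcls (s ++ t).
Proof. by apply/tclsP/tens_cat; apply: tens_repr. Qed.

Definition tmapl (f : X -> X) (s : seq (X * Y)) :=
  [seq (f xy.1, xy.2) | xy <- s].
Definition tmapr (g : Y -> Y) (s : seq (X * Y)) :=
  [seq (xy.1, g xy.2) | xy <- s].

Lemma tmapl_eq (f : X -> X) s t :
    f 0 = 0 -> {morph f : x x' / x + x'} ->
    (forall x b, f (x <* b) = f x <* b) ->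
  tens_eq s t -> tens_eq (tmapl f s) (tmapl f t).
Proof.
move=> f0 fD fb; rewrite /tmapl.
elim=> {s t} [s|s t _|s t u _ st _ tu|s s' t t' _ ss _ tt|s t|y|x x' y|x y y'|x b y] /=.
- exact: tens_refl.
- exact: tens_sym.
- exact: tens_trans st tu.
- by rewrite !map_cat; apply: tens_cat.
- by rewrite !map_cat; apply: tens_catC.
- by rewrite f0; apply: tens_0l.
- by rewrite fD; apply: tens_Dl.
- exact: tens_Dr.
- by rewrite fb; apply: tens_bal.
Qed.

Lemma tmapr_eq (g : Y -> Y) s t :
    {morph g : y y' / y + y'} -> (forall b y, g (b *> y) = b *> g y) ->
  tens_eq s t -> tens_eq (tmapr g s) (tmapr g t).
Proof.
move=> gD gb; rewrite /tmapr.
elim=> {s t} [s|s t _|s t u _ st _ tu|s s' t t' _ ss _ tt|s t|y|x x' y|x y y'|x b y] /=.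
- exact: tens_refl.
- exact: tens_sym.
- exact: tens_trans st tu.
- by rewrite !map_cat; apply: tens_cat.
- by rewrite !map_cat; apply: tens_catC.
- exact: tens_0l.
- exact: tens_Dl.
- by rewrite gD; apply: tens_Dr.
- by rewrite gb; apply: tens_bal.
Qed.

Lemma tmapl_comp (f f' : X -> X) s : tmapl f (tmapl f' s) = tmapl (f \o f') s.
Proof. by rewrite /tmapl -map_comp. Qed.

Lemma tmapl_id s : tmapl id s = s.
Proof. by rewrite /tmapl; elim: s => //= -[x y] s ->. Qed.

Lemma eq_tmapl (f f' : X -> X) s : f =1 f' -> tmapl f s = tmapl f' s.
Proof. by move=> ff'; apply: eq_map => xy; rewrite ff'. Qed.

Lemma tmapr_comp (g g' : Y -> Y) s : tmapr g (tmapr g' s) = tmapr (g \o g') s.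
Proof. by rewrite /tmapr -map_comp. Qed.

Lemma tmapr_id s : tmapr id s = s.
Proof. by rewrite /tmapr; elim: s => //= -[x y] s ->. Qed.

Lemma eq_tmapr (g g' : Y -> Y) s : g =1 g' -> tmapr g s = tmapr g' s.
Proof. by move=> gg'; apply: eq_map => xy; rewrite gg'. Qed.

Lemma tmaplr (f : X -> X) (g : Y -> Y) s :
  tmapl f (tmapr g s) = tmapr g (tmapl f s).
Proof. by rewrite /tmapl /tmapr -!map_comp. Qed.

Lemma tens_catACA (s t u v : seq (X * Y)) :
  tens_eq ((s ++ t) ++ (u ++ v)) ((s ++ u) ++ (t ++ v)).
Proof.
rewrite -!catA; apply: tens_cat; first exact: tens_refl.
by rewrite !catA; apply: tens_cat; [apply: tens_catC | apply: tens_refl].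
Qed.

Lemma tmapl_add (f f' : X -> X) s :
  tens_eq (tmapl (fun x => f x + f' x) s) (tmapl f s ++ tmapl f' s).
Proof.
elim: s => [|[x y] s IHs] /=; first exact: tens_refl.
apply: tens_trans (tens_cat (tens_Dl _ _ _) IHs) _.
exact: (tens_catACA [:: _] [:: _]).
Qed.

Lemma tmapr_add (g g' : Y -> Y) s :
  tens_eq (tmapr (fun y => g y + g' y) s) (tmapr g s ++ tmapr g' s).
Proof.
elim: s => [|[x y] s IHs] /=; first exact: tens_refl.
apply: tens_trans (tens_cat (tens_Dr _ _ _) IHs) _.
exact: (tens_catACA [:: _] [:: _]).
Qed.

Lemma tmapl_0 s : tens_eq (tmapl (fun=> 0) s) [::].
Proof.
elim: s => [|[x y] s IHs] /=; first exact: tens_refl.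
exact: (tens_cat (tens_0l y) IHs).
Qed.

Lemma tmapr_scale (c : k) s :
  tens_eq (tmapr ( *:%R c) s) (tmapl ( *:%R c) s).
Proof.
elim: s => [|[x y] s IHs] /=; first exact: tens_refl.
apply: (@tens_cat [:: _] [:: _] _ _ _ IHs).
have <- : x <* (c *: 1) = c *: x by rewrite ractZr ract1.
have <- : (c *: 1) *> y = c *: y by rewrite lactZl lact1.
exact/tens_sym/tens_bal.
Qed.

Definition tzero : tens := tcls [::].
Definition topp (u : tens) : tens := tcls (tmapl -%R (repr u)).
Definition tscale (c : k) (u : tens) : tens := tcls (tmapl ( *:%R c) (repr u)).
Definition tlact (a : A) (u : tens) : tens :=
  tcls (tmapl (fun x => a *> x) (repr u)).
Definition tract (u : tens) (c : C) : tens :=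
  tcls (tmapr (fun y => y <* c) (repr u)).

Lemma topp_cls s : topp (tcls s) = tcls (tmapl -%R s).
Proof.
apply/tclsP/tmapl_eq; [exact: oppr0 | exact: opprD | | exact: tens_repr].
by move=> x b; rewrite -!scaleN1r ractZl.
Qed.

Lemma tscale_cls c s : tscale c (tcls s) = tcls (tmapl ( *:%R c) s).
Proof.
apply/tclsP/tmapl_eq; [exact: scaler0 | exact: scalerDr | | exact: tens_repr].
by move=> x b; rewrite ractZl.
Qed.

Lemma tlact_cls a s : tlact a (tcls s) = tcls (tmapl (fun x => a *> x) s).
Proof.
apply/tclsP/tmapl_eq; [exact: lact0r | exact: lactDr | | exact: tens_repr].
by move=> x b; rewrite lractA.
Qed.

Lemma tract_cls s c : tract (tcls s) c = tcls (tmapr (fun y => y <* c) s).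
Proof.
apply/tclsP/tmapr_eq; [by move=> y y'; rewrite ractDl | | exact: tens_repr].
by move=> b y; rewrite lractA.
Qed.

Fact taddA : associative tadd.
Proof.
elim/tens_ind=> s; elim/tens_ind=> t; elim/tens_ind=> u.
by rewrite !tadd_cls catA.
Qed.
Fact taddC : commutative tadd.
Proof.
elim/tens_ind=> s; elim/tens_ind=> t.
by rewrite !tadd_cls; apply/tclsP/tens_catC.
Qed.
Fact tadd0 : left_id tzero tadd.
Proof. by elim/tens_ind=> s; rewrite tadd_cls. Qed.
Fact taddN : left_inverse tzero topp tadd.
Proof.
elim/tens_ind=> s; rewrite topp_cls tadd_cls; apply/tclsP.
apply: tens_trans (tmapl_0 s); rewrite -{2}(tmapl_id s).
rewrite -(@eq_tmapl (fun x => - x + x) (fun=> 0)); last by move=> x; rewrite addNr.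
exact/tens_sym/tmapl_add.
Qed.
HB.instance Definition _ := GRing.isZmodule.Build tens taddA taddC tadd0 taddN.

Lemma tclsD s t : tcls (s ++ t) = tcls s + tcls t.
Proof. by rewrite -tadd_cls. Qed.

Fact tscaleA c d u : tscale c (tscale d u) = tscale (c * d) u.
Proof.
elim/tens_ind: u => s; rewrite !tscale_cls tmapl_comp.
by congr tcls; apply: eq_tmapl => x /=; rewrite scalerA.
Qed.
Fact tscale1 : left_id 1 tscale.
Proof.
elim/tens_ind=> s; rewrite tscale_cls -[in RHS](tmapl_id s).
by congr tcls; apply: eq_tmapl => x; rewrite scale1r.
Qed.
Fact tscaleDr : right_distributive tscale +%R.
Proof.
move=> c; elim/tens_ind=> s; elim/tens_ind=> t.
by rewrite -tclsD !tscale_cls -tclsD /tmapl map_cat.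
Qed.
Fact tscaleDl u : {morph tscale^~ u : c d / c + d}.
Proof.
elim/tens_ind: u => s c d; rewrite !tscale_cls -tclsD; apply/tclsP.
apply: tens_trans (tmapl_add _ _ s).
rewrite (@eq_tmapl _ (fun x => c *: x + d *: x)); first exact: tens_refl.
by move=> x; rewrite scalerDl.
Qed.
HB.instance Definition _ := GRing.Zmodule_isLmodule.Build k tens
  tscaleA tscale1 tscaleDr tscaleDl.

Lemma tclsZ c s : c *: tcls s = tcls (tmapl ( *:%R c) s).
Proof. by rewrite -tscale_cls. Qed.

Fact tlactPl u c a a' : tlact (c *: a + a') u = c *: tlact a u + tlact a' u.
Proof.
elim/tens_ind: u => s; rewrite !tlact_cls tclsZ -tclsD; apply/tclsP.
rewrite tmapl_comp; apply: tens_trans (tmapl_add _ _ s).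
rewrite (@eq_tmapl _ (fun x => c *: (a *> x) + a' *> x)).
  exact: tens_refl.
by move=> x; rewrite lactDl lactZl.
Qed.
Fact tlactPr a c u v : tlact a (c *: u + v) = c *: tlact a u + tlact a v.
Proof.
elim/tens_ind: u => s; elim/tens_ind: v => t.
rewrite tclsZ -tclsD !tlact_cls tclsZ -tclsD {1}/tmapl map_cat.
congr (tcls (_ ++ _)); rewrite -![map _ _]/(tmapl _ _) !tmapl_comp.
by apply: eq_tmapl => x /=; rewrite lactZr.
Qed.
Fact tlact_bilinear : bilinear_for *:%R *:%R tlact.
Proof. by split=> [u c a a'|a c u v]; [apply: tlactPl | apply: tlactPr]. Qed.
HB.instance Definition _ :=
  bilinear_isBilinear.Build k A tens tens *:%R *:%R tlact tlact_bilinear.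

Fact tractPl c' c u v : tract (c *: u + v) c' = c *: tract u c' + tract v c'.
Proof.
elim/tens_ind: u => s; elim/tens_ind: v => t.
rewrite tclsZ -tclsD !tract_cls tclsZ -tclsD {1}/tmapr map_cat.
by congr (tcls (_ ++ _)); rewrite -[LHS]/(tmapr (fun y => y <* c') _) tmaplr.
Qed.
Fact tractPr u c d d' : tract u (c *: d + d') = c *: tract u d + tract u d'.
Proof.
elim/tens_ind: u => s; rewrite !tract_cls tclsZ -tclsD; apply/tclsP.
rewrite (@eq_tmapr _ (fun y => c *: (y <* d) + y <* d')); last first.
  by move=> y; rewrite ractDr ractZr.
apply: tens_trans (tmapr_add _ _ s) _; apply: tens_cat; last exact: tens_refl.
apply: tens_trans (tmapr_scale c _); rewrite tmapr_comp; exact: tens_refl.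
Qed.
Fact tract_bilinear : bilinear_for *:%R *:%R tract.
Proof. by split=> [c' c u v|u c d d']; [apply: tractPl | apply: tractPr]. Qed.
HB.instance Definition _ :=
  bilinear_isBilinear.Build k tens C tens *:%R *:%R tract tract_bilinear.

Fact tlact1 u : tlact 1 u = u.
Proof.
elim/tens_ind: u => s; rewrite tlact_cls -[in RHS](tmapl_id s).
by congr tcls; apply: eq_tmapl => x; rewrite lact1.
Qed.
Fact tlactA a a' u : tlact a (tlact a' u) = tlact (a * a') u.
Proof.
elim/tens_ind: u => s; rewrite !tlact_cls tmapl_comp.
by congr tcls; apply: eq_tmapl => x /=; rewrite lactA.
Qed.
Fact tract1 u : tract u 1 = u.
Proof.
elim/tens_ind: u => s; rewrite tract_cls -[in RHS](tmapr_id s).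
by congr tcls; apply: eq_tmapr => y; rewrite ract1.
Qed.
Fact tractA u c c' : tract (tract u c) c' = tract u (c * c').
Proof.
elim/tens_ind: u => s; rewrite !tract_cls tmapr_comp.
by congr tcls; apply: eq_tmapr => y /=; rewrite ractA.
Qed.
Fact tlractA a u c : tlact a (tract u c) = tract (tlact a u) c.
Proof.
by elim/tens_ind: u => s; rewrite tract_cls !tlact_cls tract_cls tmaplr.
Qed.

Definition tensor : bimod A C :=
  @Bimod k A C tens tlact tract tlact1 tlactA tract1 tractA tlractA.

Lemma tpureDl x x' y : tpure (x + x') y = tpure x y + tpure x' y.
Proof. by rewrite -tclsD; apply/tclsP/tens_Dl. Qed.
Lemma tpureDr x y y' : tpure x (y + y') = tpure x y + tpure x y'.
Proof. by rewrite -tclsD; apply/tclsP/tens_Dr. Qed.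
Lemma tpure_bal x b y : tpure (x <* b) y = tpure x (b *> y).
Proof. exact/tclsP/tens_bal. Qed.
Lemma tpureZl c x y : tpure (c *: x) y = c *: tpure x y.
Proof. by rewrite tclsZ. Qed.
Lemma tpureZr c x y : tpure x (c *: y) = c *: tpure x y.
Proof. by rewrite tclsZ; apply/tclsP; apply: (tmapr_scale c [:: (x, y)]). Qed.
Lemma tpureL a x y : (a *> (tpure x y : tensor)) = tpure (a *> x) y.
Proof. exact: (tlact_cls a [:: (x, y)]). Qed.
Lemma tpureR x y c : ((tpure x y : tensor) <* c) = tpure x (y <* c).
Proof. exact: (tract_cls [:: (x, y)] c). Qed.

Lemma tcls_sum s : tcls s = \sum_(xy <- s) tpure xy.1 xy.2.
Proof.
elim: s => [|[x y] s IHs]; first by rewrite big_nil.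
by rewrite big_cons -IHs -tclsD.
Qed.

Section Lift.
Variables (V : zmodType) (F : X -> Y -> V).
Hypothesis FDl : forall x x' y, F (x + x') y = F x y + F x' y.
Hypothesis FDr : forall x y y', F x (y + y') = F x y + F x y'.
Hypothesis Fbal : forall x b y, F (x <* b) y = F x (b *> y).

Definition tlift (u : tens) : V := \sum_(xy <- repr u) F xy.1 xy.2.

Lemma tlift_cls s : tlift (tcls s) = \sum_(xy <- s) F xy.1 xy.2.
Proof.
rewrite /tlift; move: (repr _) (tens_repr s) => r; elim=> {r s} //.
- by move=> s t u _ -> _ ->.
- by move=> s s' t t' _ ss _ tt; rewrite !big_cat /= ss tt.
- by move=> s t; rewrite !big_cat /= addrC.
- move=> y; rewrite big_seq1 big_nil /=.
  by apply: (addrI (F 0 y)); rewrite -FDl !addr0.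
- by move=> x x' y; rewrite big_seq1 !big_cons big_nil /= addr0.
- by move=> x y y'; rewrite big_seq1 !big_cons big_nil /= addr0.
- by move=> x b y; rewrite !big_seq1 /=.
Qed.

Lemma tlift_pure x y : tlift (tpure x y) = F x y.
Proof. by rewrite tlift_cls big_seq1. Qed.

Lemma tliftD u v : tlift (u + v) = tlift u + tlift v.
Proof.
elim/tens_ind: u => s; elim/tens_ind: v => t.
by rewrite -tclsD !tlift_cls big_cat.
Qed.

End Lift.

End Tensor.

Definition Morita_equivalent (k : fieldType) (R S : algType k) : Prop :=
  exists (X : bimod R S) (Y : bimod S R),
    inhabited (bimod_iso (tensor X Y) (regular R)) /\
    inhabited (bimod_iso (tensor Y X) (regular S)).

(* The two pairings are the values of the bimodule isomorphisms on pure tensors. *)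
Record morita_data (k : fieldType) (A B : algType k) := MoritaData {
  mP : bimod A B;
  mQ : bimod B A;
  isoA : bimod_iso (tensor mP mQ) (regular A);
  isoB : bimod_iso (tensor mQ mP) (regular B);
  compatP : forall (p p' : mP) (q : mQ),
    (isoA (tpure p q) : A) *> p' = p <* (isoB (tpure q p') : B);
  compatQ : forall (q q' : mQ) (p : mP),
    (isoB (tpure q p) : B) *> q' = q <* (isoA (tpure p q') : A)
}.

Section Pairings.
Variables (k : fieldType) (A B : algType k) (M : morita_data A B).
Local Notation P := (mP M).
Local Notation Q := (mQ M).

Definition pairA (p : P) (q : Q) : A := isoA M (tpure p q).
Definition pairB (q : Q) (p : P) : B := isoB M (tpure q p).

Lemma pairA_act p q p' : pairA p q *> p' = p <* pairB q p'.
Proof. exact: compatP. Qed.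
Lemma pairB_act q p q' : pairB q p *> q' = q <* pairA p q'.
Proof. exact: compatQ. Qed.

Lemma pairADl p p' q : pairA (p + p') q = pairA p q + pairA p' q.
Proof. by rewrite /pairA tpureDl raddfD. Qed.
Lemma pairADr p q q' : pairA p (q + q') = pairA p q + pairA p q'.
Proof. by rewrite /pairA tpureDr raddfD. Qed.
Lemma pairAZr c p q : pairA p (c *: q) = c *: pairA p q.
Proof. by rewrite /pairA tpureZr linearZ. Qed.
Lemma pairAL a p q : pairA (a *> p) q = a * pairA p q.
Proof. by rewrite /pairA -tpureL isoL. Qed.
Lemma pairAR p q a : pairA p (q <* a) = pairA p q * a.
Proof. by rewrite /pairA -tpureR isoR. Qed.
Lemma pairBDl q q' p : pairB (q + q') p = pairB q p + pairB q' p.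
Proof. by rewrite /pairB tpureDl raddfD. Qed.
Lemma pairBDr q p p' : pairB q (p + p') = pairB q p + pairB q p'.
Proof. by rewrite /pairB tpureDr raddfD. Qed.
Lemma pairBZr c q p : pairB q (c *: p) = c *: pairB q p.
Proof. by rewrite /pairB tpureZr linearZ. Qed.
Lemma pairBBr q p p' : pairB q (p - p') = pairB q p - pairB q p'.
Proof. by rewrite -!scaleN1r pairBDr pairBZr. Qed.
Lemma pairBL b q p : pairB (b *> q) p = b * pairB q p.
Proof. by rewrite /pairB -tpureL isoL. Qed.
Lemma pairBR q p b : pairB q (p <* b) = pairB q p * b.
Proof. by rewrite /pairB -tpureR isoR. Qed.
Lemma pairB_bal q a p : pairB (q <* a) p = pairB q (a *> p).
Proof. by rewrite /pairB tpure_bal. Qed.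

Lemma pairA_sumr I (r : seq I) p (F : I -> Q) :
  pairA p (\sum_(i <- r) F i) = \sum_(i <- r) pairA p (F i).
Proof.
apply: (big_morph (pairA p) (pairADr p)).
by apply: (addrI (pairA p 0)); rewrite -pairADr !addr0.
Qed.
Lemma pairB_suml I (r : seq I) (F : I -> Q) p :
  pairB (\sum_(i <- r) F i) p = \sum_(i <- r) pairB (F i) p.
Proof.
apply: (big_morph (pairB^~ p) (fun x y => pairBDl x y p)).
by apply: (addrI (pairB 0 p)); rewrite -pairBDl !addr0.
Qed.
Lemma pairB_sumr I (r : seq I) q (F : I -> P) :
  pairB q (\sum_(i <- r) F i) = \sum_(i <- r) pairB q (F i).
Proof.
apply: (big_morph (pairB q) (pairBDr q)).
by apply: (addrI (pairB q 0)); rewrite -pairBDr !addr0.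
Qed.

End Pairings.

Section Hochschild.
Variables (k : fieldType) (A : algType k).

(* k-linear maps out of A (x)_k A are represented by k-bilinear maps. *)
Record cocycle2 := Cocycle2 {
  cfun :> {bilinear A -> A -> A};
  cocycle2P : forall a0 a1 a2 : A,
    a0 * cfun a1 a2 + cfun a0 (a1 * a2) = cfun (a0 * a1) a2 + cfun a0 a1 * a2
}.

HB.instance Definition _ := gen_eqMixin cocycle2.
HB.instance Definition _ := gen_choiceMixin cocycle2.

Definition cobound (h : A -> A) (a0 a1 : A) : A :=
  a0 * h a1 - h (a0 * a1) + h a0 * a1.

Definition cohomologous (f g : cocycle2) : Prop :=
  exists h : {linear A -> A}, forall a0 a1, f a0 a1 - g a0 a1 = cobound h a0 a1.

Definition coh_rel : rel cocycle2 := fun f g => `[< cohomologous f g >].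

Fact coh_rel_refl : reflexive coh_rel.
Proof.
move=> f; apply/asboolP; exists (\0 : {linear A -> A}) => a0 a1.
by rewrite /cobound /= mulr0 mul0r subrr subr0 addr0.
Qed.
Fact coh_rel_sym : symmetric coh_rel.
Proof.
suff H f g : cohomologous f g -> cohomologous g f.
  by move=> f g; apply/asboolP/asboolP; apply: H.
case=> h fg; exists (\- h : {linear A -> A}) => a0 a1.
rewrite -opprB fg /cobound /= mulrN mulNr; do !rewrite opprD; by rewrite !opprK.
Qed.
Fact coh_rel_trans : transitive coh_rel.
Proof.
move=> g f e /asboolP[h fg] /asboolP[h' ge]; apply/asboolP.
exists (h \+ h' : {linear A -> A}) => a0 a1.
rewrite -(subrKA (g a0 a1)) fg ge /cobound /= mulrDr mulrDl opprD.
by rewrite addrACA; congr (_ + _); rewrite addrACA.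
Qed.
Canonical coh_equiv := EquivRel coh_rel coh_rel_refl coh_rel_sym coh_rel_trans.

Definition HH2 := {eq_quot coh_equiv}.
HB.instance Definition _ := Choice.on HH2.
HB.instance Definition _ := EqQuotient.on HH2.

Definition hclass (f : cocycle2) : HH2 := \pi_HH2 f.

Lemma hclassP f g : hclass f = hclass g <-> cohomologous f g.
Proof.
split; first by move/eqmodP/asboolP.
by move=> fg; apply/eqmodP/asboolP.
Qed.

End Hochschild.

Section Transfer.
Variables (k : fieldType) (A B : algType k) (M : morita_data A B).
Variables (m : nat) (q : 'I_m -> mQ M) (p : 'I_m -> mP M).

Definition phi2_fun (f : A -> A -> A) (b1 b2 : B) : B :=
  \sum_(i0 < m) \sum_(i1 < m) \sum_(i2 < m)
    pairB (q i0) (f (pairA (p i0) (b1 *> q i1))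
                    (pairA (p i1) (b2 *> q i2)) *> p i2).

Fact phi2Pl (f : {bilinear A -> A -> A}) b c u v :
  phi2_fun f (c *: u + v) b = c *: phi2_fun f u b + phi2_fun f v b.
Proof.
rewrite /phi2_fun.
do 3![rewrite scaler_sumr -big_split; apply: eq_bigr => ? _].
by rewrite /= lactDl lactZl pairADr pairAZr linearPl lactDl lactZl pairBDr pairBZr.
Qed.
Fact phi2Pr (f : {bilinear A -> A -> A}) b c u v :
  phi2_fun f b (c *: u + v) = c *: phi2_fun f b u + phi2_fun f b v.
Proof.
rewrite /phi2_fun.
do 3![rewrite scaler_sumr -big_split; apply: eq_bigr => ? _].
by rewrite /= lactDl lactZl pairADr pairAZr linearPr lactDl lactZl pairBDr pairBZr.
Qed.
Fact phi2_bilinear (f : {bilinear A -> A -> A}) :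
  bilinear_for *:%R *:%R (phi2_fun f).
Proof. by split=> b c u v; [apply: phi2Pl | apply: phi2Pr]. Qed.
HB.instance Definition _ (f : {bilinear A -> A -> A}) :=
  bilinear_isBilinear.Build k B B B *:%R *:%R (phi2_fun f) (phi2_bilinear f).

Hypothesis qp1 : 1 = \sum_(i < m) pairB (q i) (p i).

Lemma mQ_expand (x : mQ M) : x = \sum_(j < m) q j <* pairA (p j) x.
Proof.
rewrite -[x in LHS]lact1 qp1 lact_suml.
by apply: eq_bigr => j _; rewrite pairB_act.
Qed.
Lemma mP_expand (x : mP M) : x = \sum_(j < m) pairA x (q j) *> p j.
Proof.
rewrite -[x in LHS]ract1 qp1 ract_sumr.
by apply: eq_bigr => j _; rewrite pairA_act.
Qed.
Lemma pairA_expand (x : mP M) (b : B) (y : mQ M) :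
  pairA x (b *> y) = \sum_(j < m) pairA x (b *> q j) * pairA (p j) y.
Proof.
rewrite {1}[y]mQ_expand lact_sumr pairA_sumr.
by apply: eq_bigr => j _; rewrite lractA pairAR.
Qed.

Lemma mulB_pair b (h : 'I_m -> mP M) :
  b * \sum_i0 pairB (q i0) (h i0) =
  \sum_i0 \sum_i1 pairB (q i0) (pairA (p i0) (b *> q i1) *> h i1).
Proof.
rewrite mulr_sumr exchange_big; apply: eq_bigr => i _ /=.
rewrite -pairBL {1}[b *> _]mQ_expand pairB_suml.
by apply: eq_bigr => j _; rewrite pairB_bal.
Qed.
Lemma pair_mulB x a i b :
  pairB x (a *> p i) * b =
  \sum_(j < m) pairB x ((a * pairA (p i) (b *> q j)) *> p j).
Proof.
rewrite -pairBR -lractA {1}[p i <* b]mP_expand lact_sumr pairB_sumr.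
apply: eq_bigr => j _; rewrite lactA; congr (pairB _ ((_ * _) *> _)).
by rewrite /pairA tpure_bal.
Qed.

Fact phi2_cocycle (f : cocycle2 A) (b0 b1 b2 : B) :
  b0 * phi2_fun f b1 b2 + phi2_fun f b0 (b1 * b2) =
  phi2_fun f (b0 * b1) b2 + phi2_fun f b0 b1 * b2.
Proof.
pose S G := \sum_(i0 < m) \sum_(i1 < m) \sum_(i2 < m) \sum_(i3 < m)
  pairB (q i0) (G (pairA (p i0) (b0 *> q i1)) (pairA (p i1) (b1 *> q i2))
                  (pairA (p i2) (b2 *> q i3)) *> p i3).
have SD G G' : S G + S G' = S (fun x y z => G x y z + G' x y z).
  rewrite /S -big_split; apply: eq_bigr => i0 _; rewrite -big_split.
  apply: eq_bigr => i1 _; rewrite -big_split; apply: eq_bigr => i2 _.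
  rewrite -big_split; apply: eq_bigr => i3 _ /=.
  by rewrite lactDl pairBDr.
have -> : b0 * phi2_fun f b1 b2 = S (fun x y z => x * f y z).
  rewrite /phi2_fun /S.
  under eq_bigr => i0 _ do rewrite -(eq_bigr _ (fun i _ => pairB_sumr _ _ _))
    -pairB_sumr.
  rewrite mulB_pair; apply: eq_bigr => i0 _; apply: eq_bigr => i1 _.
  rewrite lact_sumr pairB_sumr; apply: eq_bigr => i2 _.
  rewrite lact_sumr pairB_sumr; apply: eq_bigr => i3 _.
  by rewrite lactA.
have -> : phi2_fun f b0 (b1 * b2) = S (fun x y z => f x (y * z)).
  rewrite /phi2_fun /S; apply: eq_bigr => i0 _; apply: eq_bigr => i1 _.
  rewrite exchange_big; apply: eq_bigr => i3 _ /=.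
  by rewrite -lactA (pairA_expand (p i1)) linear_sumr lact_suml pairB_sumr.
have -> : phi2_fun f (b0 * b1) b2 = S (fun x y z => f (x * y) z).
  rewrite /phi2_fun /S; apply: eq_bigr => i0 _.
  rewrite [RHS]exchange_big; apply: eq_bigr => i2 _ /=.
  rewrite exchange_big; apply: eq_bigr => i3 _ /=.
  rewrite -lactA pairA_expand linear_sumlz lact_suml pairB_sumr.
  by [].
have -> : phi2_fun f b0 b1 * b2 = S (fun x y z => f x y * z).
  rewrite /phi2_fun /S mulr_suml; apply: eq_bigr => i0 _.
  rewrite mulr_suml; apply: eq_bigr => i1 _.
  rewrite mulr_suml; apply: eq_bigr => i2 _.
  exact: pair_mulB.
rewrite !SD; do 4![apply: eq_bigr => ? _].
by rewrite cocycle2P.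
Qed.

Definition phi2 (f : cocycle2 A) : cocycle2 B :=
  @Cocycle2 k B (phi2_fun f) (phi2_cocycle f).

Definition phi1 (h : A -> A) (b : B) : B :=
  \sum_(i0 < m) \sum_(i1 < m)
    pairB (q i0) (h (pairA (p i0) (b *> q i1)) *> p i1).

Fact phi1P (h : {linear A -> A}) c u v :
  phi1 h (c *: u + v) = c *: phi1 h u + phi1 h v.
Proof.
rewrite /phi1.
do 2![rewrite scaler_sumr -big_split; apply: eq_bigr => ? _].
by rewrite /= lactDl lactZl pairADr pairAZr linearP lactDl lactZl pairBDr pairBZr.
Qed.
Fact phi1_linear (h : {linear A -> A}) : linear (phi1 h).
Proof. by move=> c u v; apply: phi1P. Qed.
HB.instance Definition _ (h : {linear A -> A}) :=
  GRing.isLinear.Build k B B *:%R (phi1 h) (phi1_linear h).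

Lemma phi2_cobound (h : {linear A -> A}) b0 b1 :
  phi2_fun (cobound h) b0 b1 = cobound (phi1 h) b0 b1.
Proof.
pose S G := \sum_(i0 < m) \sum_(i1 < m) \sum_(i2 < m)
  pairB (q i0) (G (pairA (p i0) (b0 *> q i1)) (pairA (p i1) (b1 *> q i2))
                *> p i2).
have SD G G' : S G + S G' = S (fun x y => G x y + G' x y).
  rewrite /S; do 3![rewrite -big_split; apply: eq_bigr => ? _].
  by rewrite /= lactDl pairBDr.
have h0 : b0 * phi1 h b1 = S (fun x y => x * h y).
  rewrite /phi1 /S.
  under eq_bigr => i0 _ do rewrite -pairB_sumr.
  rewrite mulB_pair; apply: eq_bigr => i0 _; apply: eq_bigr => i1 _.
  rewrite lact_sumr pairB_sumr; apply: eq_bigr => i2 _.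
  by rewrite lactA.
have h1 : phi1 h (b0 * b1) = S (fun x y => h (x * y)).
  rewrite /phi1 /S; apply: eq_bigr => i0 _.
  rewrite [RHS]exchange_big; apply: eq_bigr => i2 _ /=.
  by rewrite -lactA pairA_expand linear_sum lact_suml pairB_sumr.
have h2 : phi1 h b0 * b1 = S (fun x y => h x * y).
  rewrite /phi1 /S mulr_suml; apply: eq_bigr => i0 _.
  by rewrite mulr_suml; apply: eq_bigr => i1 _; apply: pair_mulB.
rewrite [RHS]/cobound h0 h1 h2 -[LHS]/(S (cobound h)).
apply: (addIr (S (fun x y => h (x * y)))); rewrite [RHS]addrAC subrK !SD /S.
by do 3![apply: eq_bigr => ? _]; rewrite /cobound addrAC subrK.
Qed.

Lemma phi2_cohomologous f g :
  cohomologous f g -> cohomologous (phi2 f) (phi2 g).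
Proof.
case=> h fg; exists (phi1 h : {linear B -> B}) => b0 b1.
rewrite -phi2_cobound /= /phi2_fun.
do 3![rewrite -sumrB; apply: eq_bigr => ? _].
by rewrite -fg lactBl pairBBr.
Qed.

Definition transfer2 (c : HH2 A) : HH2 B := hclass (phi2 (repr c)).

Lemma transfer2E f : transfer2 (hclass f) = hclass (phi2 f).
Proof.
by apply/hclassP/phi2_cohomologous/hclassP; rewrite /hclass reprK.
Qed.

End Transfer.

(* A[t]/(t^2) as a k-space; the pair (a, b) stands for a + b t.  The cocycle is
   a parameter so that the algebra structure below is keyed on it. *)
Definition deform (k : fieldType) (A : algType k) (f : cocycle2 A) : Type :=
  (A * A)%type.

Section Deformation.
Variables (k : fieldType) (A : algType k) (f : cocycle2 A).

Local Notation deform := (deform f).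

HB.instance Definition _ := GRing.Lmodule.copy deform (A * A)%type.

(* The unit is (1, 0) only when f is normalised. *)
Definition deform_one : deform := (1, - f 1 1).
Definition deform_mul (u v : deform) : deform :=
  (u.1 * v.1, u.1 * v.2 + u.2 * v.1 + f u.1 v.1).

Fact deform_mulA : associative deform_mul.
Proof.
move=> [a0 b0] [a1 b1] [a2 b2]; rewrite /deform_mul /= mulrA; congr pair.
rewrite !mulrDr !mulrDl !mulrA -!addrA; do 2!congr (_ + _).
by rewrite addrCA (cocycle2P f a0 a1 a2) [X in _ + X = _]addrC.
Qed.
Fact deform_mul1 : left_id deform_one deform_mul.
Proof.
move=> [a b]; rewrite /deform_mul /= !mul1r mulNr; congr pair.
have := cocycle2P f 1 1 a; rewrite !mul1r => /addrI ->.
by rewrite subrK.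
Qed.
Fact deform_1mul : right_id deform_one deform_mul.
Proof.
move=> [a b]; rewrite /deform_mul /= !mulr1 mulrN; congr pair.
have := cocycle2P f a 1 1; rewrite !mulr1 addrC => /addrI ->.
by rewrite addrAC addNr add0r.
Qed.
Fact deform_mulDl : left_distributive deform_mul +%R.
Proof.
move=> [a b] [a' b'] [c d]; rewrite /deform_mul /= mulrDl; congr pair.
by rewrite /= !mulrDl linearDl [RHS]addrACA; congr (_ + _); rewrite addrACA.
Qed.
Fact deform_mulDr : right_distributive deform_mul +%R.
Proof.
move=> [c d] [a b] [a' b']; rewrite /deform_mul /= mulrDr; congr pair.
by rewrite /= !mulrDr linearDr [RHS]addrACA; congr (_ + _); rewrite addrACA.
Qed.
Fact deform_1_neq0 : deform_one != 0.
Proof. by apply/eqP => -[/eqP]; rewrite oner_eq0. Qed.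
HB.instance Definition _ := GRing.Zmodule_isNzRing.Build deform
  deform_mulA deform_mul1 deform_1mul deform_mulDl deform_mulDr deform_1_neq0.

Fact deform_scaleAl (c : k) (u v : deform) :
  c *: (u * v) = (c *: u : deform) * v.
Proof.
case: u v => [a b] [a' b']; congr pair; first exact: scalerAl.
rewrite /= !scalerDr !scalerAl; congr (_ + _).
exact: esym (linearZl_LR f _ _ _).
Qed.
HB.instance Definition _ :=
  GRing.Lmodule_isLalgebra.Build k deform deform_scaleAl.
Fact deform_scaleAr (c : k) (u v : deform) :
  c *: (u * v) = u * (c *: v : deform).
Proof.
case: u v => [a b] [a' b']; congr pair; first exact: scalerAr.
rewrite /= !scalerDr !scalerAr; congr (_ + _).
exact: esym (linearZr_LR f _ _ _).
Qed.
HB.instance Definition _ :=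
  GRing.Lalgebra_isAlgebra.Build k deform deform_scaleAr.

Lemma deform_mulE (u v : deform) :
  u * v = (u.1 * v.1, u.1 * v.2 + u.2 * v.1 + f u.1 v.1).
Proof. by []. Qed.

End Deformation.

(* Main.v *)
(* Regard the Morita data as a k-linear category with two objects, whose hom
   spaces are A, P, Q and B.  Both objects are summands of multiples of the
   object A, through 1_A = 1_A 1_A and 1_B = sum <q_k, p_k>; the formula of the
   transfer map therefore makes sense on all hom spaces and extends f to a
   2-cocycle of the whole category, which is f on A and phi^2(f) on B.  The
   deformation of the category along this cocycle has endomorphism algebras A_f
   and B_{phi^2(f)}, and the latter is isomorphic to B_g.  The two objects still
   generate each other, since such relations lift along a nilpotent ideal, so
   the off-diagonal hom spaces are the required bimodules. *)
Require Import Defs.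
From HB Require Import structures.
From mathcomp Require Import all_boot all_algebra boolp.

Set Implicit Arguments.
Unset Strict Implicit.
Unset Printing Implicit Defensive.

Import GRing.Theory.

Local Open Scope ring_scope.

(** * Tensor products recognised through a Morita context *)

Section TensorIso.
Variables (k : fieldType) (R S : algType k) (X : bimod R S) (Y : bimod S R).
Variables (mu : X -> Y -> R) (nu : Y -> X -> S) (s : seq (X * Y)).
Hypothesis muDl : forall x x' y, mu (x + x') y = mu x y + mu x' y.
Hypothesis muDr : forall x y y', mu x (y + y') = mu x y + mu x y'.
Hypothesis mu_bal : forall x b y, mu (x <* b) y = mu x (b *> y).
Hypothesis muL : forall a x y, mu (a *> x) y = a * mu x y.
Hypothesis muR : forall x y a, mu x (y <* a) = mu x y * a.
Hypothesis mu_nu : forall x y x', mu x y *> x' = x <* nu y x'.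
Hypothesis nu_mu : forall y x y', nu y x *> y' = y <* mu x y'.
Hypothesis mu1 : \sum_(xy <- s) mu xy.1 xy.2 = 1.

Let lift : tensor X Y -> regular R := tlift mu.

Let liftL a u : lift (a *> u) = a * lift u.
Proof.
elim/tens_ind: u => t; rewrite [_ *> _]tlact_cls /lift !tlift_cls // /tmapl.
by rewrite big_map mulr_sumr; apply: eq_bigr => xy _ /=; rewrite muL.
Qed.

Let liftR u a : lift (u <* a) = lift u * a.
Proof.
elim/tens_ind: u => t; rewrite [_ <* _]tract_cls /lift !tlift_cls // /tmapr.
by rewrite big_map mulr_suml; apply: eq_bigr => xy _ /=; rewrite muR.
Qed.

Fact lift_linear : linear lift.
Proof.
move=> c u v; rewrite /lift tliftD //; congr (_ + _).
(* Homogeneity follows from [R]-linearity, since [c] acts as the element [c *: 1] of [R]. *)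
rewrite -[u in LHS](lact1 u) -lactZl [LHS]liftL.
by rewrite -scalerAl mul1r.
Qed.
HB.instance Definition _ :=
  GRing.isLinear.Build k (tensor X Y) (regular R) *:%R lift lift_linear.

(** With [w] the tensor of the list [s], one has [lift w = 1] and [u = lift u *> w] for every [u],
    so [a |-> a *> w] is a two-sided inverse of [lift]. *)
Lemma tensor_iso_of_context : bimod_iso (tensor X Y) (regular R).
Proof.
apply: (@BimodIso _ _ _ (tensor X Y) (regular R) lift).
- exact: liftL.
- exact: liftR.
pose w : tensor X Y := tcls s.
exists (fun a => a *> w) => [|a]; last first.
  by rewrite [LHS]liftL /lift tlift_cls // mu1 mulr1.
elim/tens_ind=> t; rewrite -[LHS]/((lift (tcls t) : R) *> w) /lift tlift_cls //.
rewrite lact_suml [RHS]tcls_sum; apply: eq_bigr => -[x y] _ /=.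
rewrite /w tcls_sum [LHS](@lact_sumr _ _ _ (tensor X Y)).
(* Summing over the entries [(x', y')] of [s], the tensor of [x] and [y] equals that of [x] and
   [y <* mu x' y'], that is [nu y x' *> y']; moving [nu y x'] across turns [x] into
   [mu x y *> x']. *)
rewrite -[y in RHS]ract1 -mu1 ract_sumr.
rewrite (big_morph (tpure x) (id1 := 0) (op1 := +%R)); first last.
- by rewrite -(scale0r y) tpureZr scale0r.
- exact: tpureDr.
apply: eq_bigr => -[x' y'] _ /=.
by rewrite tpureL mu_nu tpure_bal nu_mu.
Qed.

End TensorIso.

(** * Linear categories and Morita equivalence of endomorphism algebras *)

(* Composition is in diagrammatic order: [a ;; b] is [a] followed by [b]. *)
Record lincat (k : fieldType) (I : Type) := Lincat {
  hom : I -> I -> lmodType k;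
  comp : forall i j l, {bilinear hom i j -> hom j l -> hom i l};
  idm : forall i, hom i i;
  compA : forall i j l n (a : hom i j) (b : hom j l) (c : hom l n),
    comp _ _ _ a (comp _ _ _ b c) = comp _ _ _ (comp _ _ _ a b) c;
  comp1l : forall i j (a : hom i j), comp _ _ _ (idm i) a = a;
  comp1r : forall i j (a : hom i j), comp _ _ _ a (idm j) = a
}.

Notation "a ;; b" := (comp _ _ _ _ a b) (at level 40, left associativity).

(** Hom spaces carry only a vector space structure, so the endomorphism algebra of [i] is presented
    by an algebra [R]; the diagrammatic order avoids opposite algebras. *)
Record end_iso (k : fieldType) (I : Type) (C : lincat k I) (i : I)
    (R : algType k) := EndIso {
  toEnd : {linear R -> hom C i i};
  ofEnd : {linear hom C i i -> R};
  toEndK : cancel toEnd ofEnd;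
  ofEndK : cancel ofEnd toEnd;
  toEnd1 : toEnd 1 = idm C i;
  toEndM : forall r r', toEnd (r * r') = toEnd r ;; toEnd r'
}.

(* [i] is, up to direct summands, generated by [j]. *)
Definition covers (k : fieldType) (I : Type) (C : lincat k I) (j i : I) :=
  exists s : seq (hom C i j * hom C j i), \sum_(xy <- s) xy.1 ;; xy.2 = idm C i.

Section HomBimod.
Variables (k : fieldType) (I : Type) (C : lincat k I) (i j : I).
Variables (R S : algType k) (phi : end_iso C i R) (psi : end_iso C j S).

Definition hom_lact (r : R) (x : hom C i j) : hom C i j := toEnd phi r ;; x.
Definition hom_ract (x : hom C i j) (s : S) : hom C i j := x ;; toEnd psi s.

Fact hom_lact_bilinear : bilinear_for *:%R *:%R hom_lact.
Proof.
split=> [x c r r'|r c x x']; rewrite /hom_lact.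
  by rewrite linearP linearPl.
by rewrite linearPr.
Qed.
HB.instance Definition _ := bilinear_isBilinear.Build k R _ _ *:%R *:%R
  hom_lact hom_lact_bilinear.

Fact hom_ract_bilinear : bilinear_for *:%R *:%R hom_ract.
Proof.
split=> [s c x x'|x c s s']; rewrite /hom_ract.
  by rewrite linearPl.
by rewrite linearP linearPr.
Qed.
HB.instance Definition _ := bilinear_isBilinear.Build k _ S _ *:%R *:%R
  hom_ract hom_ract_bilinear.

Fact hom_lact1 x : hom_lact 1 x = x.
Proof. by rewrite /hom_lact toEnd1 comp1l. Qed.
Fact hom_lactA r r' x : hom_lact r (hom_lact r' x) = hom_lact (r * r') x.
Proof. by rewrite /hom_lact toEndM compA. Qed.
Fact hom_ract1 x : hom_ract x 1 = x.
Proof. by rewrite /hom_ract toEnd1 comp1r. Qed.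
Fact hom_ractA x s s' : hom_ract (hom_ract x s) s' = hom_ract x (s * s').
Proof. by rewrite /hom_ract toEndM compA. Qed.
Fact hom_lractA r x s : hom_lact r (hom_ract x s) = hom_ract (hom_lact r x) s.
Proof. exact: compA. Qed.

Definition hom_bimod : bimod R S := @Bimod k R S (hom C i j) hom_lact hom_ract
  hom_lact1 hom_lactA hom_ract1 hom_ractA hom_lractA.

End HomBimod.

(** Composition in the two orders gives both pairings of a Morita context, whose laws reduce to
    bilinearity and associativity; the cover of [i] by [j] is the list on which the pairing sums to
    1. *)
Lemma hom_tensor_iso (k : fieldType) (I : Type) (C : lincat k I) (i j : I)
    (R S : algType k) (phi : end_iso C i R) (psi : end_iso C j S) :
    covers C j i ->
  inhabited (bimod_iso (tensor (hom_bimod phi psi) (hom_bimod psi phi))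
                       (regular R)).
Proof.
case=> s s1; split.
pose mu (x : hom_bimod phi psi) (y : hom_bimod psi phi) := ofEnd phi (x ;; y).
pose nu (y : hom_bimod psi phi) (x : hom_bimod phi psi) := ofEnd psi (y ;; x).
apply: (@tensor_iso_of_context _ _ _ (hom_bimod phi psi) (hom_bimod psi phi)
  mu nu s); rewrite /mu /nu.
- by move=> x x' y; rewrite linearDl raddfD.
- by move=> x y y'; rewrite linearDr raddfD.
- by move=> x b y /=; rewrite /hom_ract /hom_lact compA.
- move=> a x y; apply: (can_inj (toEndK phi)).
  by rewrite toEndM !ofEndK /= /hom_lact compA.
- move=> x y a; apply: (can_inj (toEndK phi)).
  by rewrite toEndM !ofEndK /= /hom_ract compA.
- by move=> x y x'; rewrite /= /hom_lact /hom_ract !ofEndK compA.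
- by move=> y x y'; rewrite /= /hom_lact /hom_ract !ofEndK compA.
- by rewrite -raddf_sum s1 -(toEnd1 phi); apply: toEndK.
Qed.

Lemma Morita_equivalent_End (k : fieldType) (I : Type) (C : lincat k I)
    (i j : I) (R S : algType k) :
  end_iso C i R -> end_iso C j S -> covers C j i -> covers C i j ->
  Morita_equivalent R S.
Proof.
move=> phi psi ij ji; exists (hom_bimod phi psi), (hom_bimod psi phi).
by split; apply: hom_tensor_iso.
Qed.

(** * Infinitesimal deformations of a linear category *)

Section Deform.
Variables (k : fieldType) (I : Type) (C : lincat k I).

Record cat_cocycle2 := CatCocycle2 {
  ccfun : forall i j l, {bilinear hom C i j -> hom C j l -> hom C i l};
  cat_cocycle2P : forall i j l n (a : hom C i j) (b : hom C j l)
      (c : hom C l n),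
    a ;; ccfun _ _ _ b c + ccfun _ _ _ a (b ;; c) =
    ccfun _ _ _ (a ;; b) c + ccfun _ _ _ a b ;; c
}.

Variable F : cat_cocycle2.

Definition dhom i j : lmodType k := (hom C i j * hom C i j)%type.
Definition dcomp i j l (u : dhom i j) (v : dhom j l) : dhom i l :=
  (u.1 ;; v.1, u.1 ;; v.2 + u.2 ;; v.1 + ccfun F _ _ _ u.1 v.1).
(** The correction is needed as [F] may fail to be normalised; the cocycle identity at [(1, 1, a)]
    gives [F(1, a) = F(1, 1) ;; a], and symmetrically on the right. *)
Definition didm i : dhom i i := (idm C i, - ccfun F _ _ _ (idm C i) (idm C i)).

Fact dcomp_bilinear i j l : bilinear_for *:%R *:%R (@dcomp i j l).
Proof.
split=> [v c u u'|u c v v']; apply: injective_projections => /=.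
- by rewrite linearPl.
- rewrite !linearPl !scalerDr.
  by rewrite [RHS]addrACA; congr (_ + _); rewrite addrACA.
- by rewrite linearPr.
- rewrite !linearPr !scalerDr.
  by rewrite [RHS]addrACA; congr (_ + _); rewrite addrACA.
Qed.
HB.instance Definition _ i j l := bilinear_isBilinear.Build k _ _ _ *:%R *:%R
  (@dcomp i j l) (@dcomp_bilinear i j l).

Fact dcompA i j l n (u : dhom i j) (v : dhom j l) (w : dhom l n) :
  dcomp u (dcomp v w) = dcomp (dcomp u v) w.
Proof.
apply: injective_projections => /=; first exact: compA.
rewrite !linearDr !linearDl !compA -!addrA; do 2!congr (_ + _).
by rewrite addrCA cat_cocycle2P [X in _ + X = _]addrC.
Qed.
Fact dcomp1l i j (u : dhom i j) : dcomp (didm i) u = u.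
Proof.
case: u => a b; apply: injective_projections => /=; first exact: comp1l.
rewrite comp1l linearNl; have := cat_cocycle2P F (idm C i) (idm C i) a.
by rewrite !comp1l => /addrI ->; rewrite subrK.
Qed.
Fact dcomp1r i j (u : dhom i j) : dcomp u (didm j) = u.
Proof.
case: u => a b; apply: injective_projections => /=; first exact: comp1r.
rewrite comp1r linearNr; have := cat_cocycle2P F a (idm C j) (idm C j).
by rewrite !comp1r addrC => /addrI ->; rewrite addrAC addNr add0r.
Qed.

Definition deform_cat : lincat k I :=
  @Lincat k I dhom (fun i j l => @dcomp i j l) didm dcompA dcomp1l dcomp1r.

Lemma sum_pair (T : Type) (U V : zmodType) (r : seq T) (f : T -> U * V) :
  \sum_(x <- r) f x = (\sum_(x <- r) (f x).1, \sum_(x <- r) (f x).2).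
Proof.
by rewrite -(raddf_sum fst) -(raddf_sum snd); case: (\sum_(x <- r) _).
Qed.

(* Lifting the cover gives [(1, c)] instead of the identity; as [t] is
   nilpotent this is invertible. *)
Lemma covers_deform i j : covers C j i -> covers deform_cat j i.
Proof.
case=> s s1.
pose c := \sum_(xy <- s) ccfun F _ _ _ xy.1 xy.2.
(* With [e = F(1, 1)], the product [(1, c) ;; (1, x)] has second component [x + c + e], which must
   be the [- e] of the deformed identity; hence [x = - e - e - c]. *)
pose w : dhom i i := (idm C i,
  - ccfun F _ _ _ (idm C i) (idm C i) - ccfun F _ _ _ (idm C i) (idm C i) - c).
exists [seq ((xy.1, 0) : dhom i j, dcomp ((xy.2, 0) : dhom j i) w) | xy <- s].
rewrite big_map /=.
under eq_bigr => xy _ do rewrite dcompA.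
rewrite -[LHS](linear_sumlz (@dcomp i i i)) sum_pair /=.
under [X in (_, X)]eq_bigr => xy _ do rewrite linear0l linear0r !add0r.
rewrite s1 -/c; apply: injective_projections => /=; first by rewrite comp1l.
by rewrite comp1l comp1r subrK subrK.
Qed.

End Deform.

(** * Extending a cocycle from one object to the whole category *)

Section Extension.
Variables (k : fieldType) (I : Type) (C : lincat k I) (o : I).
Variable f : {bilinear hom C o o -> hom C o o -> hom C o o}.
Hypothesis f_cocycle : forall a b c : hom C o o,
  a ;; f b c + f a (b ;; c) = f (a ;; b) c + f a b ;; c.
Variable r : forall i, seq (hom C i o * hom C o i).
Hypothesis r1 : forall i, \sum_(x <- r i) x.1 ;; x.2 = idm C i.

(** The covers turn an arrow [a] from [i] to [j] into a matrix with entries [x.2 ;; (a ;; y.1)] in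
    the endomorphisms of [o]; here [f] replaces multiplication in the product of two such matrices,
    and the result is read back as an arrow. *)
Definition ext_fun i j l (a : hom C i j) (b : hom C j l) : hom C i l :=
  \sum_(x <- r i) \sum_(y <- r j) \sum_(z <- r l)
    x.1 ;; (f (x.2 ;; (a ;; y.1)) (y.2 ;; (b ;; z.1)) ;; z.2).

Fact ext_fun_bilinear i j l : bilinear_for *:%R *:%R (@ext_fun i j l).
Proof.
split=> [b c u v|a c u v]; rewrite /ext_fun /=.
  do 3![rewrite scaler_sumr -big_split; apply: eq_bigr => ? _ /=].
  by rewrite /= linearPl linearPr linearPl linearPl linearPr.
do 3![rewrite scaler_sumr -big_split; apply: eq_bigr => ? _ /=].
by rewrite /= linearPl 2!linearPr linearPl linearPr.
Qed.
HB.instance Definition _ i j l := bilinear_isBilinear.Build k _ _ _ *:%R *:%R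
  (@ext_fun i j l) (@ext_fun_bilinear i j l).

Lemma cover_expand i j (b : hom C i j) : b = \sum_(x <- r i) x.1 ;; (x.2 ;; b).
Proof.
rewrite -[b in LHS]comp1l -r1 linear_sumlz.
by apply: eq_bigr => x _; rewrite compA.
Qed.

(** Inserting the cover of the middle object shows that the matrix of a composite is the product of
    the matrices. *)
Lemma cover_expand_mid h i j l n
    (u : hom C h i) (a : hom C i j) (b : hom C j l) (v : hom C l n) :
  u ;; (a ;; b ;; v) = \sum_(x <- r j) (u ;; (a ;; x.1)) ;; (x.2 ;; (b ;; v)).
Proof.
rewrite -compA {1}(cover_expand (b ;; v)) !linear_sumr.
by apply: eq_bigr => x _; rewrite !compA.
Qed.

Lemma cover_expandr i j (a : hom C i j) : a = \sum_(x <- r j) (a ;; x.1) ;; x.2.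
Proof.
rewrite -[a in LHS]comp1r -r1 linear_sumr.
by apply: eq_bigr => x _; rewrite compA.
Qed.

(** All four terms become quadruple sums over the matrix entries of the three arrows, and there the
    identity is [f_cocycle] summand by summand. *)
Fact ext_cocycle i j l n (a : hom C i j) (b : hom C j l) (c : hom C l n) :
  a ;; ext_fun b c + ext_fun a (b ;; c) = ext_fun (a ;; b) c + ext_fun a b ;; c.
Proof.
pose S (G : hom C o o -> hom C o o -> hom C o o -> hom C o o) :=
  \sum_(x <- r i) \sum_(y <- r j) \sum_(z <- r l) \sum_(w <- r n)
  x.1 ;; (G (x.2 ;; (a ;; y.1)) (y.2 ;; (b ;; z.1)) (z.2 ;; (c ;; w.1)) ;; w.2).
have SD G G' : S G + S G' = S (fun x y z => G x y z + G' x y z).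
  rewrite /S; do 4![rewrite -big_split; apply: eq_bigr => ? _].
  by rewrite /= linearDl linearDr.
have -> : a ;; ext_fun b c = S (fun x y z => x ;; f y z).
  rewrite /ext_fun /S linear_sumr [RHS]exchange_big; apply: eq_bigr => y _ /=.
  rewrite linear_sumr [RHS]exchange_big; apply: eq_bigr => z _ /=.
  rewrite linear_sumr [RHS]exchange_big; apply: eq_bigr => w _ /=.
  (* The sum over [r i] is absent on the left; expanding [a ;; y.1] along the cover of [i] supplies
     it. *)
  rewrite compA {1}(cover_expand (a ;; y.1)) linear_sumlz.
  by apply: eq_bigr => x _; rewrite !compA.
have -> : ext_fun a (b ;; c) = S (fun x y z => f x (y ;; z)).
  rewrite /ext_fun /S; apply: eq_bigr => x _; apply: eq_bigr => y _.
  rewrite [RHS]exchange_big; apply: eq_bigr => w _ /=.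
  by rewrite cover_expand_mid linear_sumr linear_sumlz linear_sumr.
have -> : ext_fun (a ;; b) c = S (fun x y z => f (x ;; y) z).
  rewrite /ext_fun /S; apply: eq_bigr => x _.
  rewrite [RHS]exchange_big; apply: eq_bigr => z _ /=.
  rewrite [RHS]exchange_big; apply: eq_bigr => w _ /=.
  by rewrite cover_expand_mid !linear_sumlz linear_sumr.
have -> : ext_fun a b ;; c = S (fun x y z => f x y ;; z).
  rewrite /ext_fun /S linear_sumlz; apply: eq_bigr => x _.
  rewrite linear_sumlz; apply: eq_bigr => y _.
  rewrite linear_sumlz; apply: eq_bigr => z _.
  rewrite -!compA {1}(cover_expandr (z.2 ;; c)) !linear_sumr.
  by apply: eq_bigr => w _; rewrite !compA.
rewrite !SD; do 4![apply: eq_bigr => ? _].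
by rewrite f_cocycle.
Qed.

Definition ext_cat_cocycle : cat_cocycle2 C :=
  @CatCocycle2 k I C (fun i j l => @ext_fun i j l) ext_cocycle.

End Extension.

(** * The two-object category of the Morita data *)

Section MoritaCategory.
Variables (k : fieldType) (A B : algType k) (M : morita_data A B).

Lemma pairA_bal (x : mP M) b y : pairA (x <* b) y = pairA x (b *> y).
Proof. by rewrite /pairA tpure_bal. Qed.
Lemma pairAZl c (x : mP M) y : pairA (c *: x) y = c *: pairA x y.
Proof. by rewrite /pairA tpureZl linearZ. Qed.
Lemma pairBZl c (y : mQ M) x : pairB (c *: y) x = c *: pairB y x.
Proof. by rewrite /pairB tpureZl linearZ. Qed.

Fact pairA_bilinear : bilinear_for *:%R *:%R (@pairA k A B M).
Proof.
by split=> [y c x x'|x c y y']; rewrite ?pairADl ?pairADr ?pairAZl ?pairAZr.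
Qed.
HB.instance Definition _ := bilinear_isBilinear.Build k _ _ _ *:%R *:%R
  (@pairA k A B M) pairA_bilinear.

Fact pairB_bilinear : bilinear_for *:%R *:%R (@pairB k A B M).
Proof.
by split=> [x c y y'|y c x x']; rewrite ?pairBDl ?pairBDr ?pairBZl ?pairBZr.
Qed.
HB.instance Definition _ := bilinear_isBilinear.Build k _ _ _ *:%R *:%R
  (@pairB k A B M) pairB_bilinear.

(* [true] stands for [A] and [false] for [B]. *)
Definition mhom (i j : bool) : lmodType k :=
  match i, j with
  | true, true => A
  | true, false => mP M
  | false, true => mQ M
  | false, false => B
  end.

Definition mcomp (i j l : bool) : {bilinear mhom i j -> mhom j l -> mhom i l} :=
  match i, j, l with
  | true, true, true => @reg_mul k A
  | true, true, false => lact (mP M)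
  | true, false, true => @pairA k A B M
  | true, false, false => ract (mP M)
  | false, true, true => ract (mQ M)
  | false, true, false => @pairB k A B M
  | false, false, true => lact (mQ M)
  | false, false, false => @reg_mul k B
  end.

Definition mid (i : bool) : mhom i i :=
  match i with true => (1 : A) | false => (1 : B) end.

(** The sixteen cases are associativity in [A] and [B], the bimodule axioms, linearity and balancing
    of the pairings, and, for the triples PQP and QPQ, the two compatibilities of the pairings. *)
Fact mcompA i j l n (a : mhom i j) (b : mhom j l) (c : mhom l n) :
  mcomp i j n a (mcomp j l n b c) = mcomp i l n (mcomp i j l a b) c.
Proof.
case: i j l n a b c => [] [] [] [] a b c /=; rewrite /reg_mul ?mulrA //.
all: rewrite ?lactA ?ractA ?lractA ?pairAL ?pairAR ?pairBL ?pairBR //.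
all: by rewrite ?pairA_bal ?pairB_bal ?pairA_act ?pairB_act.
Qed.

Fact mcomp1l i j (a : mhom i j) : mcomp i i j (mid i) a = a.
Proof. by case: i j a => [] [] a; rewrite /= ?lact1 // /reg_mul mul1r. Qed.
Fact mcomp1r i j (a : mhom i j) : mcomp i j j a (mid j) = a.
Proof. by case: i j a => [] [] a; rewrite /= ?ract1 // /reg_mul mulr1. Qed.

Definition morita_cat : lincat k bool :=
  @Lincat k bool mhom mcomp mid mcompA mcomp1l mcomp1r.

(** The fixed elements [q], [p] decompose only the unit of [B]; for the unit of [A] a decomposition
    is read off a representative of its preimage under [isoA]. *)
Lemma morita_cat_coversA : covers morita_cat false true.
Proof.
have [h _ hK] := iso_bij (isoA M); exists (repr (h 1)).
rewrite -[RHS]/(1 : A) -[RHS]hK -[h 1 in RHS]reprK [X in isoA M X]tcls_sum.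
by rewrite raddf_sum.
Qed.

End MoritaCategory.

(** * Endomorphism algebras of the deformed category *)

(* For a coboundary [f - g = dh], [a + b t |-> a + (b - h a) t] carries the
   product of [deform g] to that of [deform f]. *)
Section DeformEnd.
Variables (k : fieldType) (I : Type) (C : lincat k I) (F : cat_cocycle2 C).
Variables (i : I) (A : algType k) (phi : end_iso C i A) (f : cocycle2 A).
Variable h : {linear A -> A}.

Hypothesis FE : forall a b : A,
  ccfun F _ _ _ (toEnd phi a) (toEnd phi b) = toEnd phi (f a b + cobound h a b).

Definition deform_toEnd (u : deform f) : hom (deform_cat F) i i :=
  (toEnd phi u.1, toEnd phi (u.2 - h u.1)).
Definition deform_ofEnd (v : hom (deform_cat F) i i) : deform f :=
  (ofEnd phi v.1, ofEnd phi v.2 + h (ofEnd phi v.1)).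

Fact deform_toEnd_linear : linear deform_toEnd.
Proof.
move=> c u v; apply: injective_projections => /=; first exact: linearP.
by rewrite (linearP h) -[RHS]linearP /= scalerBr opprD addrACA.
Qed.
HB.instance Definition _ := GRing.isLinear.Build k (deform f) _ *:%R
  deform_toEnd deform_toEnd_linear.

Fact deform_ofEnd_linear : linear deform_ofEnd.
Proof.
move=> c u v; apply: injective_projections => /=; first exact: linearP.
by rewrite (linearP (ofEnd phi)) linearP linearP scalerDr addrACA.
Qed.
HB.instance Definition _ := GRing.isLinear.Build k _ (deform f) *:%R
  deform_ofEnd deform_ofEnd_linear.

Lemma deform_end_iso : end_iso (deform_cat F) i (deform f).
Proof.
apply: (@EndIso _ _ (deform_cat F) i (deform f) deform_toEnd deform_ofEnd).
- by case=> a b; rewrite /= /deform_ofEnd /= !toEndK subrK.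
- by case=> a b; rewrite /= /deform_toEnd /= addrK !ofEndK.
- apply: injective_projections => /=; first exact: toEnd1.
  (* As [cobound h 1 1 = h 1], the shift by [- h 1] turns [- f 1 1] into minus the value of [F] at
     the identities. *)
  rewrite -(toEnd1 phi) FE /cobound !mulr1 mul1r subrK -[RHS]raddfN /=.
  by rewrite opprD.
- case=> a b [a' b']; apply: injective_projections => /=; first exact: toEndM.
  rewrite FE -!toEndM -!raddfD; congr (toEnd phi _) => /=.
  rewrite /cobound mulrBr mulrBl (addrACA (a * b')) -opprD -!addrA.
  do 2!congr (_ + _); rewrite [RHS]addrCA; congr (_ + _).
  by rewrite [X in _ + X]addrCA [RHS]addrCA addNr addr0.
Qed.

End DeformEnd.

(** Kept transparent, so that [toEnd] reduces to the identity and the values of a cocycle on [A] and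
    [B] match the hypothesis [FE] by conversion. *)
Lemma morita_cat_endA (k : fieldType) (A B : algType k) (M : morita_data A B) :
  end_iso (morita_cat M) true A.
Proof. by apply: (@EndIso _ _ (morita_cat M) true A idfun idfun). Defined.

Lemma morita_cat_endB (k : fieldType) (A B : algType k) (M : morita_data A B) :
  end_iso (morita_cat M) false B.
Proof. by apply: (@EndIso _ _ (morita_cat M) false B idfun idfun). Defined.

Theorem theorem4p4 (k : fieldType) (A B : algType k) (M : morita_data A B)
    (m : nat) (q : 'I_m -> mQ M) (p : 'I_m -> mP M)
    (qp1 : 1 = \sum_(i < m) pairB (q i) (p i))
    (f : cocycle2 A) (g : cocycle2 B)
    (fg : transfer2 qp1 (hclass f) = hclass g) :
  Morita_equivalent (deform f) (deform g).
Proof.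
move: fg; rewrite transfer2E => /hclassP[h fgh].
pose C := morita_cat M.
(* The trivial cover of [true] makes the extension restrict to [f] itself on [A]; the cover of
   [false] by the [q j], [p j] makes it [phi2_fun] on [B]. *)
pose r (i : bool) : seq (hom C i true * hom C true i) :=
  match i with
  | true => [:: (1 : A, 1 : A)]
  | false => [seq (q j, p j) | j <- index_enum 'I_m]
  end.
have r1 i : \sum_(x <- r i) x.1 ;; x.2 = idm C i.
  case: i; first by rewrite big_seq1; apply: mul1r.
  by rewrite big_map; apply: esym qp1.
pose F := @ext_cat_cocycle k bool C true (cfun f) (cocycle2P f) r r1.
have FA (a b : A) : ccfun F true true true a b =
    f a b + cobound (\0 : {linear A -> A}) a b.
  rewrite /= /ext_fun !big_seq1 /= /reg_mul !mul1r !mulr1.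
  by rewrite /cobound /= mulr0 mul0r subr0 !addr0.
(* On [B] the extension is only cohomologous to [g]; the [h] witnessing this is the one by which the
   endomorphism algebra is identified with [deform g]. *)
have FB (a b : B) : ccfun F false false false a b = g a b + cobound h a b.
  rewrite -fgh addrC subrK /= /ext_fun big_map; apply: eq_bigr => i _.
  by rewrite big_map; apply: eq_bigr => j _; rewrite big_map.
apply: (@Morita_equivalent_End k bool (deform_cat F) true false).
- exact: (@deform_end_iso _ _ _ _ _ _ (morita_cat_endA M) f \0).
- exact: (@deform_end_iso _ _ _ _ _ _ (morita_cat_endB M) g h).
- exact/covers_deform/morita_cat_coversA.
- by apply: covers_deform; exists (r false); apply: (r1 false).
Qed.
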